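(* Consider AdaHedge for adversarial linear bandits (described in the context) with exploration distribution $\pi$ as in the context and exploration rates $\gamma_t=\min\bigl\{1/2,\ \sqrt{2.5\,d\ln K}\;t^{-1/2}\bigr\}$. Then for all real $m<M$ with $m\le0\le M$ and all oblivious sequences $y_1,y_2,\dots$ in $\mathbb{R}^d$ satisfying $\langle x,y_t\rangle\in[m,M]$ for all $t\ge1$ and all $x\in\mathcal{A}$, for all $T\ge1$, \[ R_T(y_{1:T})\le 12(M-m)\sqrt{dT\ln K}+18(M-m)\,d\ln K . \]
   Context: Oblivious adversarial linear bandits: a finite action set $\mathcal{A}\subset\mathbb{R}^d$ of cardinality $K\ge2$ that spans $\mathbb{R}^d$. The environment fixes beforehand vectors $y_t\in\mathbb{R}^d$, $t\ge1$. At round $t$ the player draws $X_t\in\mathcal{A}$ from a distribution $p_t$ on $\mathcal{A}$ and observes only $\langle X_t,y_t\rangle$. The range $[m,M]$ is unknown to the player. Regret: $R_T(y_{1:T})=\max_{x\in\mathcal{A}}\sum_{t=1}^T\langle x,y_t\rangle-\mathbb{E}[\sum_{t=1}^T\langle X_t,y_t\rangle]$. For a distribution $p$ on $\mathcal{A}$, $M(p)=\sum_{x\in\mathcal{A}}p(x)\,xx^\top$. The exploration distribution $\pi$ on $\mathcal{A}$ is chosen so that $M(\pi)$ is invertible and $\max_{x\in\mathcal{A}}x^\top M(\pi)^{-1}x=d$ (such $\pi$ exists when $\mathcal{A}$ spans $\mathbb{R}^d$). Algorithm: $\eta_1=+\infty$, $q_1$ uniform on $\mathcal{A}$. For $t\ge1$: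 $p_t=(1-\gamma_t)q_t+\gamma_t\pi$; draw $X_t\sim p_t$; observe $\langle X_t,y_t\rangle$; set $\widehat y_t=M(p_t)^{-1}X_t\langle X_t,y_t\rangle$; compute $\delta_t=-\sum_{x}q_t(x)\langle x,\widehat y_t\rangle+\frac1{\eta_t}\ln\bigl(\sum_x q_t(x)e^{\eta_t\langle x,\widehat y_t\rangle}\bigr)$ if $\eta_t<\infty$ and $\delta_t=-\sum_x q_t(x)\langle x,\widehat y_t\rangle+\max_x\langle x,\widehat y_t\rangle$ if $\eta_t=\infty$; set $\eta_{t+1}=\ln K/\sum_{s=1}^t\delta_s$; set $q_{t+1}(a)\propto\exp\bigl(\eta_{t+1}\sum_{s=1}^t\langle a,\widehat y_s\rangle\bigr)$, normalized over $a\in\mathcal{A}$. *)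

(* Defs.v *)
From mathcomp Require Import all_boot all_order all_algebra.
From mathcomp Require Import all_classical all_reals all_analysis.
Set Implicit Arguments. Unset Strict Implicit. Unset Printing Implicit Defensive.
Import Order.TTheory GRing.Theory Num.Theory.
Local Open Scope ring_scope.

Section AdaHedge.
Variables (R : realType) (d K : nat).

Definition ip (x y : 'cV[R]_d) : R := (x^T *m y) 0 0.

Definition Mmat (a : 'I_K -> 'cV[R]_d) (p : 'I_K -> R) : 'M[R]_d :=
  \sum_(i < K) p i *: (a i *m (a i)^T).

Definition is_distr (p : 'I_K -> R) : Prop :=
  (forall i, 0 <= p i) /\ \sum_(i < K) p i = 1.

Definition good_exploration (a : 'I_K -> 'cV[R]_d) (pi : 'I_K -> R) : Prop :=
  is_distr pi /\ Mmat a pi \in unitmx /\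
  (forall i, ((a i)^T *m invmx (Mmat a pi) *m a i) 0 0 <= d%:R) /\
  (exists i, ((a i)^T *m invmx (Mmat a pi) *m a i) 0 0 = d%:R).

Definition gamma (t : nat) : R :=
  Num.min (1 / 2) (Num.sqrt (5 / 2 * d%:R * ln K%:R) / Num.sqrt t%:R).

(* Algorithm state after some rounds: cumulative estimate sum_s yhat_s and
   cumulative mixability gap sum_s delta_s. *)
Record state := State { cumY : 'cV[R]_d ; cumD : R }.

Definition init_state : state := State 0 0.

(* learning rate eta = ln K / sum delta; None stands for +infinity
   (the case sum delta = 0, in particular eta_1 = +infinity) *)
Definition eta_of (s : state) : option R :=
  if cumD s == 0 then None else Some (ln K%:R / cumD s).

(* q_t: exponential weights; for eta = +infinity, the limit distribution,
   uniform over the maximizers of the cumulative estimates (this gives the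
   uniform q_1 at the start) *)
Definition qdist (a : 'I_K -> 'cV[R]_d) (s : state) (i : 'I_K) : R :=
  match eta_of s with
  | Some e => expR (e * ip (a i) (cumY s)) /
              \sum_(j < K) expR (e * ip (a j) (cumY s))
  | None => let A := [set j : 'I_K | [forall k, ip (a k) (cumY s) <= ip (a j) (cumY s)]] in
            if i \in A then 1 / (#|A|%:R) else 0
  end.

Definition pdist (a : 'I_K -> 'cV[R]_d) (pi : 'I_K -> R) (t : nat) (s : state)
  (i : 'I_K) : R :=
  (1 - gamma t) * qdist a s i + gamma t * pi i.

Definition step (a : 'I_K -> 'cV[R]_d) (pi : 'I_K -> R) (y : nat -> 'cV[R]_d)
  (t : nat) (s : state) (x : 'I_K) : state :=
  let yhat := ip (a x) (y t) *: (invmx (Mmat a (pdist a pi t s)) *m a x) in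
  let mean := \sum_(i < K) qdist a s i * ip (a i) yhat in
  let delta := match eta_of s with
    | Some e => - mean + 1 / e * ln (\sum_(i < K) qdist a s i * expR (e * ip (a i) yhat))
    | None => - mean + \big[Num.max / ip (a x) yhat]_(i < K) ip (a i) yhat
    end in
  State (cumY s + yhat) (cumD s + delta).

Definition state_after (a : 'I_K -> 'cV[R]_d) (pi : 'I_K -> R) (y : nat -> 'cV[R]_d)
  (h : seq 'I_K) : state :=
  (foldl (fun ts x => (ts.1.+1, step a pi y ts.1.+1 ts.2 x)) (0%N, init_state) h).2.

Definition traj_prob (a : 'I_K -> 'cV[R]_d) (pi : 'I_K -> R) (y : nat -> 'cV[R]_d)
  (T : nat) (h : T.-tuple 'I_K) : R :=
  \prod_(i < T) pdist a pi i.+1 (state_after a pi y (take i h)) (tnth h i).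

Definition expected_reward (a : 'I_K -> 'cV[R]_d) (pi : 'I_K -> R)
  (y : nat -> 'cV[R]_d) (T : nat) : R :=
  \sum_(h : T.-tuple 'I_K) traj_prob a pi y h * \sum_(i < T) ip (a (tnth h i)) (y i.+1).

Definition regret_le (a : 'I_K -> 'cV[R]_d) (pi : 'I_K -> R)
  (y : nat -> 'cV[R]_d) (T : nat) (B : R) : Prop :=
  forall x : 'I_K, \sum_(i < T) ip (a x) (y i.+1) - expected_reward a pi y T <= B.

End AdaHedge.

(* Main.v *)
(* Write D_t for the cumulative mixability gap after t rounds, so that
   eta_{t+1} = ln K / D_t.  On every trajectory the power mean
   (1/eta) ln (1/K sum_i exp (eta G_i)) of the cumulative estimates, which is
   nondecreasing in eta, bounds the regret on the estimates by 2 D_T.  Expanding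
   D_T^2 = sum_t (delta_t^2 + 2 delta_t D_{t-1}) and bounding each delta_t by
   Bernstein's inequality gives D_T^2 <= ln K * V_T + B D_T, where V_T sums the
   second moments of the estimates under q_t and
   B = (2/3 ln K + 1) * 2 (M - m) d / gamma_T.  Exploration bounds
   x^T M(p_t)^-1 x' by d / gamma_t, the trace identity
   E [X_t^T M(p_t)^-1 X_t] = d gives E V_T <= 2 d (M - m)^2 T, and mixing with pi
   costs (M - m) sum_t gamma_t. *)
Require Import Defs.
From mathcomp Require Import all_boot all_order all_algebra.
From mathcomp Require Import all_classical all_reals all_analysis.
From mathcomp Require Import ring lra.
Import Order.TTheory GRing.Theory Num.Theory.
Local Open Scope ring_scope.
Set Implicit Arguments. Unset Strict Implicit. Unset Printing Implicit Defensive.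

(** * Elementary bounds on exp, ln 2 and sums of inverse square roots *)

Section RealInequalities.
Variable R : realType.
Implicit Types (b r u x z : R).

Lemma ge0_is_derive_le (f df : R -> R) (x y : R) :
  (forall z, is_derive z 1 f (df z)) ->
  (forall z, x <= z <= y -> 0 <= df z) -> x <= y -> f x <= f y.
Proof.
move=> fdf df0 xy.
have [|z zxy eqf] := MVT_segment xy (fun z _ => fdf z).
  by apply: derivable_within_continuous => z _; case: (fdf z).
rewrite -subr_ge0 eqf mulr_ge0 ?subr_ge0//.
by apply: df0; move: zxy; rewrite in_itv.
Qed.

(** The derivative is - exp(-z) z^2 / 2 <= 0 and [rem 0 = 1], so exp lies below its quadratic Taylor
    polynomial for z <= 0 and above it for z >= 0. *)
Let rem z : R := expR (- z) * (1 + z + z ^+ 2 / 2).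

Let rem_le x z : x <= z -> rem z <= rem x.
Proof.
move=> xz; rewrite -lerN2; apply: (@ge0_is_derive_le (fun z => - rem z)
  (fun z => expR (- z) * (z ^+ 2 / 2))) => // [w|w _]; last first.
  by rewrite mulr_ge0 ?expR_ge0// divr_ge0 ?sqr_ge0.
rewrite /rem; apply: is_derive_eq.
by rewrite /= /GRing.scale /= ; field.
Qed.

Lemma expR_le_quad_npos z : z <= 0 -> expR z <= 1 + z + z ^+ 2 / 2.
Proof.
move=> z0; have := rem_le z0; rewrite /rem oppr0 expR0 expr0n/= mul0r !addr0 mulr1.
by rewrite expRN ler_pdivlMl ?expR_gt0// mulr1.
Qed.

Let rem_le1 z : 0 <= z -> rem z <= 1.
Proof.
by move=> /rem_le; rewrite {2}/rem oppr0 expR0 expr0n/= mul0r !addr0 mulr1.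
Qed.

(* The right-hand side is the [2/1] Pade approximant of exp, multiplied out. *)
Lemma expR_pade z : 0 <= z ->
  expR z * (1 - z / 3) <= 1 + 2 / 3 * z + z ^+ 2 / 6.
Proof.
move=> z0.
pose f x : R := expR (- x) * (1 + 2 / 3 * x + x ^+ 2 / 6) - 1 + x / 3.
have : f 0 <= f z.
  apply: (@ge0_is_derive_le f (fun x => (1 - rem x) / 3)) => // [w|w /andP[w0 _]].
    rewrite /f; apply: is_derive_eq.
    by rewrite /= /GRing.scale /= /rem; field.
  by rewrite divr_ge0// subr_ge0 rem_le1.
rewrite /f oppr0 expR0 expr0n/= !(mulr0, mul0r) !addr0 mulr1 subrr => h.
have : 1 - z / 3 <= expR (- z) * (1 + 2 / 3 * z + z ^+ 2 / 6) by lra.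
by rewrite expRN ler_pdivlMl ?expR_gt0.
Qed.

(** For z <= 0 the quadratic bound suffices, since 1 - b/3 <= 1. For 0 < z <= b, dividing the Pade
    bound by 1 - z/3 gives the claim with denominator 1 - z/3, which is then lowered to 1 - b/3. *)
Lemma expR_bernstein b z : 0 <= b -> b < 3 -> z <= b ->
  expR z <= 1 + z + z ^+ 2 / 2 / (1 - b / 3).
Proof.
move=> b0 b3 zb; have c0 : 0 < 1 - b / 3 by lra.
have [z0|z0] := leP z 0.
  apply: (le_trans (expR_le_quad_npos z0)); rewrite lerD2l.
  by rewrite ler_pdivlMr// ler_piMr ?divr_ge0 ?sqr_ge0//; lra.
have cz0 : 0 < 1 - z / 3 by lra.
apply: (@le_trans _ _ (1 + z + z ^+ 2 / 2 / (1 - z / 3))).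
  have -> : 1 + z + z ^+ 2 / 2 / (1 - z / 3) =
            (1 + 2 / 3 * z + z ^+ 2 / 6) / (1 - z / 3).
    by field; lra.
  by rewrite ler_pdivlMr// expR_pade// ltW.
by rewrite lerD2l ler_pM2l ?lef_pV2 ?posrE//; [lra|rewrite divr_gt0 ?exprn_gt0].
Qed.

(** Bernoulli's inequality x^r >= 1 + r (x - 1) at x = exp u; it follows from two uses of exp v >= 1
    + v. *)
Lemma expR_bernoulli r u : 1 <= r -> 1 + r * (expR u - 1) <= expR (r * u).
Proof.
move=> r1; have -> : r * u = u + (r - 1) * u by ring.
rewrite expRD; apply: (@le_trans _ _ (expR u * (1 + (r - 1) * u))); last first.
  by rewrite ler_pM2l ?expR_gt0// expR_ge1Dx.
have h : expR u - 1 <= expR u * u.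
  have := expR_ge1Dx (- u); rewrite expRN => /(ler_wpM2l (expR_ge0 u)).
  by rewrite mulfV ?gt_eqF ?expR_gt0//; lra.
have := ler_wpM2l (_ : 0 <= r - 1) h; rewrite subr_ge0 => /(_ r1); lra.
Qed.

(* From 2 = (5/4) (6/5) (7/6) (8/7) and ln (n / (n - 1)) >= 1/n. *)
Lemma ln2_ge : 19 / 30 <= ln (2 : R).
Proof.
have le_ln (n m : R) : 0 < m -> n = m + 1 -> n^-1 <= ln (n / m).
  move=> m0 nE; have n0 : 0 < n by lra.
  have := @le_ln1Dx R (- n^-1); rewrite ltrN2 invf_lt1//.
  have -> : 1 + - n^-1 = (n / m)^-1 by rewrite nE; field; lra.
  by rewrite lnV ?posrE ?divr_gt0//; lra.
have -> : (2 : R) = (5 / 4) * (6 / 5) * (7 / 6) * (8 / 7) by field.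
do 3 (rewrite lnM ?posrE; try by lra).
have h5 := le_ln 5 4; have h6 := le_ln 6 5; have h7 := le_ln 7 6; have h8 := le_ln 8 7.
move: (h5 ltac:(lra) ltac:(lra)) (h6 ltac:(lra) ltac:(lra)).
move: (h7 ltac:(lra) ltac:(lra)) (h8 ltac:(lra) ltac:(lra)).
lra.
Qed.

Lemma sum_inv_sqrt (n : nat) :
  \sum_(i < n) (Num.sqrt (i.+1%:R : R))^-1 <= 2 * Num.sqrt n%:R.
Proof.
elim: n => [|n ih]; first by rewrite big_ord0 mulr_ge0 ?sqrtr_ge0.
rewrite big_ord_recr/=.
set s := Num.sqrt (n.+1%:R : R); set t := Num.sqrt (n%:R : R) in ih *.
have s0 : 0 < s by rewrite sqrtr_gt0.
have t0 : 0 <= t := sqrtr_ge0 _.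
have st : s ^+ 2 = t ^+ 2 + 1 by rewrite !sqr_sqrtr// -natr1.
suff : s^-1 <= 2 * (s - t) by lra.
rewrite -[s^-1]mul1r ler_pdivrMr//.
(* As s^2 - t^2 = 1, the goal 1 <= 2 (s - t) s amounts to (s - t)^2 >= 0. *)
have := sqr_ge0 (s - t); rewrite sqrrB; nra.
Qed.

End RealInequalities.

(** * Mixability gap and exponential-weights potential *)

Section MixabilityGap.
Variables (R : realType) (K : nat).
Implicit Types (q g : 'I_K -> R) (e b : R).

Definition mean q g : R := \sum_(i < K) q i * g i.

Definition gap e q g : R :=
  - mean q g + 1 / e * ln (\sum_(i < K) q i * expR (e * g i)).

Lemma mean_le q g b : is_distr q -> (forall i, g i <= b) -> mean q g <= b.
Proof.
move=> [q0 q1] gb; rewrite -[leRHS]mul1r -q1 mulr_suml.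
by apply: ler_sum => i _; rewrite ler_wpM2l.
Qed.

Lemma mean_ge q g b : is_distr q -> (forall i, b <= g i) -> b <= mean q g.
Proof.
move=> [q0 q1] gb; rewrite -[leLHS]mul1r -q1 mulr_suml.
by apply: ler_sum => i _; rewrite ler_wpM2l.
Qed.

Section Centered.
Variables (q g : 'I_K -> R) (e : R).
Hypotheses (qd : is_distr q) (e0 : 0 < e).

Let mgf : R := \sum_(i < K) q i * expR (e * (g i - mean q g)).

Let sum_centered : \sum_(i < K) q i * (e * (g i - mean q g)) = 0.
Proof.
under eq_bigr do rewrite mulrCA mulrBr.
rewrite -mulr_sumr big_split/= sumrN -mulr_suml.
by case: qd => _ ->; rewrite mul1r subrr mulr0.
Qed.

Let mgf_ge1 : 1 <= mgf.
Proof.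
have [q0 q1] := qd.
rewrite -[leLHS]addr0 -sum_centered -[X in X + _]q1 -big_split/=.
by apply: ler_sum => i _; rewrite -{1}[q i]mulr1 -mulrDr ler_wpM2l// expR_ge1Dx.
Qed.

(** Centering [g] absorbs the term [- mean q g] into the logarithm. *)
Let gapE : gap e q g = ln mgf / e.
Proof.
rewrite /gap.
have -> : \sum_(i < K) q i * expR (e * g i) = expR (e * mean q g) * mgf.
  rewrite mulr_sumr; apply: eq_bigr => i _.
  by rewrite mulrCA -expRD; congr (_ * expR _); ring.
rewrite lnM ?posrE ?expR_gt0 ?(lt_le_trans ltr01)//.
by rewrite expRK; field; rewrite gt_eqF.
Qed.

Lemma gap_ge0 : 0 <= gap e q g.
Proof. by rewrite gapE divr_ge0 ?ln_ge0// ltW. Qed.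

Lemma gap_le b : (forall i, g i - mean q g <= b) -> gap e q g <= b.
Proof.
move=> gb; rewrite gapE ler_pdivrMr// -[leRHS]expRK ler_ln ?posrE ?expR_gt0//.
  by apply: mean_le => // i; rewrite ler_expR mulrC ler_pM2r.
exact: lt_le_trans ltr01 mgf_ge1.
Qed.

Let variance_le : \sum_(i < K) q i * (g i - mean q g) ^+ 2 <=
  \sum_(i < K) q i * g i ^+ 2.
Proof.
have [q0 q1] := qd.
have -> : \sum_(i < K) q i * (g i - mean q g) ^+ 2 =
    \sum_(i < K) q i * g i ^+ 2 - mean q g ^+ 2.
  transitivity (\sum_(i < K) (q i * g i ^+ 2 - 2 * mean q g * (q i * g i)
                              + q i * mean q g ^+ 2)).
    by apply: eq_bigr => i _; ring.
  rewrite !big_split/= sumrN -mulr_sumr -mulr_suml q1 -/(mean q g); ring.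
by rewrite lerBlDr lerDl sqr_ge0.
Qed.

(** The factor 2 / e is kept on the left because at e = ln K / D it produces 2 D gap / ln K, the
    cross term in the expansion of D^2. *)
Lemma gap_bernstein b : 0 <= b -> (forall i, g i - mean q g <= b) ->
  2 / e * gap e q g <= \sum_(i < K) q i * g i ^+ 2 + 2 / 3 * b * gap e q g.
Proof.
move=> b0 gb; have [q0 q1] := qd; have d0 := gap_ge0.
suff h : 2 / e * gap e q g <=
    \sum_(i < K) q i * (g i - mean q g) ^+ 2 + 2 / 3 * b * gap e q g.
  by apply: (le_trans h); rewrite lerD2r.
set v := \sum_(i < K) _.
have v0 : 0 <= v by apply: sumr_ge0 => i _; rewrite mulr_ge0// sqr_ge0.
(* If e b >= 3 then 2 / e <= 2 b / 3 and the linear term alone dominates; otherwise ln x <= x - 1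
   and Bernstein's bound apply, with positive denominator 1 - e b / 3. *)
have [eb|eb] := leP 3 (e * b).
  have : 2 / e * gap e q g <= 2 / 3 * b * gap e q g.
    by rewrite ler_wpM2r// ler_pdivrMr//; lra.
  by move/le_trans; apply; rewrite lerDr.
have c0 : 0 < 1 - e * b / 3 by lra.
have : e * gap e q g <= e ^+ 2 * v / 2 / (1 - e * b / 3).
  rewrite gapE [leLHS]mulrC divfK ?gt_eqF//.
  have -> : ln mgf = ln (1 + (mgf - 1)) by congr ln; ring.
  apply: (le_trans (le_ln1Dx _)); first by have := mgf_ge1; lra.
  rewrite lerBlDl -[X in X + _]addr0 -sum_centered -{1}q1 -big_split/= /v.
  rewrite mulr_sumr !mulr_suml -big_split/=.
  apply: ler_sum => i _.
  have -> : q i + q i * (e * (g i - mean q g)) +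
      e ^+ 2 * (q i * (g i - mean q g) ^+ 2) / 2 / (1 - e * b / 3) =
      q i * (1 + e * (g i - mean q g) +
             (e * (g i - mean q g)) ^+ 2 / 2 / (1 - e * b / 3)).
    by rewrite exprMn; ring.
  rewrite ler_wpM2l// expR_bernstein ?mulr_ge0 ?(ltW e0)//.
  by rewrite ler_pM2l.
rewrite ler_pdivlMr// => h.
have e20 : 0 < e ^+ 2 / 2 by rewrite divr_gt0 ?exprn_gt0.
rewrite -(ler_pM2l e20).
have -> : e ^+ 2 / 2 * (2 / e * gap e q g) = e * gap e q g.
  by field; rewrite gt_eqF.
move: h; lra.
Qed.

End Centered.

(* [expw_le D G C] says that the power mean [(1/e) ln (1/K sum_i exp (e G_i))]
   at [e = ln K / D] (the maximum of [G] when [D = 0], i.e. [e = +oo]) is at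
   most [C]. *)
Definition expw_le (D : R) (G : 'I_K -> R) (C : R) : Prop :=
  if D == 0 then forall i, G i <= C
  else \sum_(i < K) expR (ln K%:R / D * (G i - C)) <= K%:R.

Hypothesis K2 : (2 <= K)%N.

Let lnK_gt0 : 0 < ln (K%:R : R).
Proof. by rewrite ln_gt0// ltr1n. Qed.

(** Power means are monotone, and a larger D means a smaller rate. Bernoulli's inequality with r =
    D' / D, the ratio of the old rate to the new, gives K + r (S - K) <= K for the sum S of
    exponentials at the new rate. *)
Lemma expw_le_mono D D' G C : 0 <= D -> D <= D' ->
  expw_le D G C -> expw_le D' G C.
Proof.
rewrite /expw_le => D0 DD'; have [D'0|D'n0] := eqVneq D' 0.
  by have -> : D = 0 by [apply/eqP; rewrite eq_le D0 -D'0 DD']; rewrite eqxx.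
have D'0 : 0 < D' by rewrite lt_def D'n0 (le_trans D0).
have [_ GC|Dn0 h] := eqVneq D 0.
  rewrite -[leRHS](_ : \sum_(i < K) 1 = _).
    apply: ler_sum => i _; rewrite expR_le1 mulr_ge0_le0 ?subr_le0//.
    by rewrite divr_ge0 ?ltW.
  by rewrite sumr_const card_ord.
have {Dn0}D0 : 0 < D by rewrite lt_def Dn0.
set e := ln K%:R / D in h; set e' := ln K%:R / D'.
have r1 : 1 <= D' / D by rewrite ler_pdivlMr// mul1r.
have : \sum_(i < K) (1 + D' / D * (expR (e' * (G i - C)) - 1)) <= K%:R.
  apply: le_trans h; apply: ler_sum => i _.
  have -> : e * (G i - C) = D' / D * (e' * (G i - C)).
    by rewrite /e /e'; field; rewrite !gt_eqF.
  exact: expR_bernoulli.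
rewrite big_split/= -mulr_sumr sumrB !sumr_const card_ord -[leRHS]addr0 lerD2l.
by rewrite pmulr_rle0 ?subr_le0// (lt_le_trans ltr01).
Qed.

(** Keeping one term of the sum gives G_i - C <= ln K / e, which is D itself by the choice of e. *)
Lemma expw_le_bound D G C i : 0 <= D -> expw_le D G C -> G i <= C + D.
Proof.
rewrite /expw_le => D0; have [->|Dn0 h] := eqVneq D 0; first by rewrite addr0.
have {Dn0}D0 : 0 < D by rewrite lt_def Dn0.
have : expR (ln K%:R / D * (G i - C)) <= K%:R.
  apply: le_trans h; rewrite (bigD1 i)//= lerDl.
  by apply: sumr_ge0 => j _; exact: expR_ge0.
rewrite -[leRHS]lnK ?posrE ?ltr0n ?(ltn_trans _ K2)// ler_expR.
by rewrite -mulrA ger_pMr// ler_pdivrMl// mulr1; lra.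
Qed.

(** Since q is proportional to the previous weights, the potential at a fixed rate grows by exactly
    ln W / e, with W the q-average of exp (e g); the two sums compared are in fact equal. *)
Lemma expw_le_step D G C g q : 0 < D ->
  (forall i, q i = expR (ln K%:R / D * G i) /
                   \sum_(j < K) expR (ln K%:R / D * G j)) ->
  expw_le D G C ->
  expw_le D (fun i => G i + g i) (C + (mean q g + gap (ln K%:R / D) q g)).
Proof.
move=> D0 qE; rewrite /expw_le gt_eqF//.
set e := ln K%:R / D in qE *; apply: le_trans.
have e0 : 0 < e by rewrite divr_gt0.
have i0 : 'I_K by exists 0%N; apply: ltn_trans K2.
have pos (F : 'I_K -> R) : 0 < \sum_(j < K) expR (F j).
  rewrite (bigD1 i0)//= ltr_pwDl ?expR_gt0//.
  by apply: sumr_ge0 => j _; exact: expR_ge0.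
set W := \sum_(i < K) q i * expR (e * g i).
have WE : W = (\sum_(i < K) expR (e * (G i + g i))) / \sum_(j < K) expR (e * G j).
  rewrite /W mulr_suml; apply: eq_bigr => i _.
  by rewrite qE mulrDr expRD mulrAC.
have W0 : 0 < W by rewrite WE divr_gt0.
have -> : mean q g + gap e q g = ln W / e by rewrite /gap -/W; field; rewrite gt_eqF.
have sumE (F : 'I_K -> R) c : \sum_(i < K) expR (e * (F i - c)) =
    (\sum_(i < K) expR (e * F i)) * expR (- (e * c)).
  by rewrite mulr_suml; apply: eq_bigr => i _; rewrite -expRD; congr expR; ring.
rewrite (sumE (fun i => G i + g i)) (sumE G).
have -> : - (e * (C + ln W / e)) = - (e * C) - ln W by field; rewrite gt_eqF.
rewrite expRD [expR (- ln W)]expRN lnK ?posrE// WE.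
set x := expR _; set N := \sum_(i < K) _; set Z := \sum_(i < K) _.
suff -> : N * (x * (N / Z)^-1) = Z * x by [].
by field; rewrite !gt_eqF ?pos.
Qed.

End MixabilityGap.

(** * The second-moment matrix P of a distribution on actions, and its inverse *)

Section DesignMatrix.
Variables (R : realType) (d K : nat) (a : 'I_K -> 'cV[R]_d).
Implicit Types (p : 'I_K -> R) (u v w x : 'cV[R]_d).

Lemma ipC u v : ip u v = ip v u.
Proof. by rewrite /ip !mxE; apply: eq_bigr => i _; rewrite !mxE mulrC. Qed.

Lemma ipDr u v w : ip u (v + w) = ip u v + ip u w.
Proof. by rewrite /ip mulmxDr mxE. Qed.

Lemma ipZr u c v : ip u (c *: v) = c * ip u v.
Proof. by rewrite /ip -scalemxAr mxE. Qed.

Lemma ip0r u : ip u 0 = 0.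
Proof. by rewrite /ip mulmx0 mxE. Qed.

Lemma ip_sumr (I : finType) u (F : I -> 'cV[R]_d) :
  ip u (\sum_i F i) = \sum_i ip u (F i).
Proof. by rewrite /ip mulmx_sumr summxE. Qed.

Lemma Mmat_mulE p v : Mmat a p *m v = \sum_(i < K) (p i * ip (a i) v) *: a i.
Proof.
rewrite /Mmat mulmx_suml; apply: eq_bigr => i _.
rewrite -scalemxAl -mulmxA [(a i)^T *m v]mx11_scalar -/(ip (a i) v).
by rewrite mul_mx_scalar scalerA.
Qed.

Lemma ip_Mmat p u v :
  ip u (Mmat a p *m v) = \sum_(i < K) p i * (ip (a i) u * ip (a i) v).
Proof.
rewrite Mmat_mulE ip_sumr; apply: eq_bigr => i _.
by rewrite ipZr [ip u _]ipC; ring.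
Qed.

Lemma trmx_Mmat p : (Mmat a p)^T = Mmat a p.
Proof.
rewrite /Mmat linear_sum/=; apply: eq_bigr => i _.
by rewrite linearZ/= trmx_mul trmxK.
Qed.

(** A kernel vector v has sum_i p_i <a_i, v>^2 = 0 with nonnegative terms, so each p_i <a_i, v>
    vanishes. *)
Lemma Mmat_unit p : (forall i, 0 <= p i) ->
  (forall u, (forall i, p i * ip (a i) u = 0) -> u = 0) -> Mmat a p \in unitmx.
Proof.
move=> p0 ker0; rewrite -row_free_unit; apply: inj_row_free => v vM.
apply: trmx_inj; rewrite trmx0; apply: ker0 => i.
have : \sum_(i < K) p i * (ip (a i) v^T * ip (a i) v^T) = 0.
  by rewrite -ip_Mmat -[Mmat a p]trmx_Mmat -trmx_mul vM trmx0 ip0r.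
move/psumr_eq0P => /(_ (fun j _ => mulr_ge0 (p0 j) (sqr_ge0 _))) /(_ i isT)/eqP.
by rewrite !mulf_eq0 orbb => /orP[]/eqP->; rewrite ?mul0r ?mulr0.
Qed.

Variables (p : 'I_K -> R).
Hypotheses (p0 : forall i, 0 <= p i) (Pu : Mmat a p \in unitmx).
Let est j := invmx (Mmat a p) *m a j.

Let mul_est j : Mmat a p *m est j = a j.
Proof. by rewrite /est mulKVmx. Qed.

Lemma ip_estE x j : ip (a j) (invmx (Mmat a p) *m x) = ip (est j) x.
Proof. by rewrite /ip /est trmx_mul trmx_inv trmx_Mmat mulmxA. Qed.

Lemma sum_ip_est_sqr j :
  \sum_(i < K) p i * ip (a i) (est j) ^+ 2 = ip (a j) (est j).
Proof. by rewrite -[in RHS]mul_est ipC ip_Mmat. Qed.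

Lemma sum_ip_est_unbiased x v :
  \sum_(j < K) p j * (ip (a j) v * ip x (est j)) = ip x v.
Proof.
rewrite -[in RHS](mulKmx Pu v) Mmat_mulE mulmx_sumr ip_sumr.
by apply: eq_bigr => j _; rewrite -scalemxAr ipZr mulrA.
Qed.

(** Each term is p_j tr (P^-1 a_j a_j^T) by cyclicity of the trace, and these add up to tr (P^-1
    P). *)
Lemma sum_ip_est_trace : \sum_(j < K) p j * ip (a j) (est j) = d%:R.
Proof.
rewrite -[RHS](mxtrace1 R d) -(mulVmx Pu) [X in _ *m X]/Mmat mulmx_sumr linear_sum/=.
apply: eq_bigr => j _; rewrite -scalemxAr linearZ/= mulmxA mxtrace_mulC.
by rewrite trace_mx11.
Qed.

Lemma ip_est_ge0 j : 0 <= ip (a j) (est j).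
Proof.
by rewrite -sum_ip_est_sqr; apply: sumr_ge0 => i _; rewrite mulr_ge0// sqr_ge0.
Qed.

(** Cauchy-Schwarz for P^-1 in its additive form: expand the nonnegative quadratic form of P at
    [est i] plus c times [est j], for c = 1 and c = -1. *)
Lemma ip_est_abs_le b : (forall j, ip (a j) (est j) <= b) ->
  forall i j, `|ip (a i) (est j)| <= b.
Proof.
move=> estb i j.
have h (c : R) : c ^+ 2 = 1 -> 0 <= b + c * ip (a i) (est j).
  move=> c2.
  have : 0 <= \sum_(k < K) p k * (ip (a k) (est i) + c * ip (a k) (est j)) ^+ 2.
    by apply: sumr_ge0 => k _; rewrite mulr_ge0// sqr_ge0.
  have -> : \sum_(k < K) p k * (ip (a k) (est i) + c * ip (a k) (est j)) ^+ 2 =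
      \sum_(k < K) p k * ip (a k) (est i) ^+ 2
      + 2 * c * (\sum_(k < K) p k * (ip (a k) (est i) * ip (a k) (est j)))
      + \sum_(k < K) p k * ip (a k) (est j) ^+ 2.
    rewrite mulr_sumr -!big_split/=; apply: eq_bigr => k _.
    by rewrite -[X in _ = _ + X]mul1r -[X in _ = _ + X * _]c2; ring.
  rewrite !sum_ip_est_sqr -ip_Mmat mul_est [ip (est i) _]ipC.
  have -> : ip (a j) (est i) = ip (a i) (est j) by rewrite [RHS]ip_estE ipC.
  by have := estb i; have := estb j; lra.
rewrite ler_norml; have := h 1; have := h (-1).
rewrite sqrrN expr1n => /(_ erefl) h1 /(_ erefl) h2.
by apply/andP; split; lra.
Qed.

End DesignMatrix.

(** * Comparison of a mixture with its exploration component *)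

Section MixedExploration.
Variables (R : realType) (d K : nat) (a : 'I_K -> 'cV[R]_d) (c : R).
Variables (p pi : 'I_K -> R).
Hypotheses (c0 : 0 < c) (pi0 : forall i, 0 <= pi i).
Hypotheses (pip : forall i, c * pi i <= p i) (Qu : Mmat a pi \in unitmx).

Let p0 i : 0 <= p i.
Proof. by apply: le_trans (pip i); rewrite mulr_ge0// ltW. Qed.

(** Since p dominates c pi, p_i = 0 forces pi_i = 0; hence a kernel vector for p is also one for
    pi. *)
Lemma mixed_Mmat_unit : Mmat a p \in unitmx.
Proof.
apply: Mmat_unit => // u pu.
rewrite -(mulKmx Qu u) Mmat_mulE big1 ?mulmx0// => i _.
suff /eqP : pi i * ip (a i) u = 0 by move=> /eqP->; rewrite scale0r.
have /eqP := pu i; rewrite mulf_eq0 => /orP[/eqP pi0'|/eqP->]; last by rewrite mulr0.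
have : c * pi i <= 0 by rewrite -pi0'.
rewrite pmulr_rle0// => pile; have -> : pi i = 0; last by rewrite mul0r.
by apply/eqP; rewrite eq_le pile pi0.
Qed.

(* The inverse is antitone on positive definite matrices: expand the square of
   [c P^-1 x - Q^-1 x] in the quadratic form of [Q]. *)
Lemma mixed_ip_est_le b j :
  ip (a j) (invmx (Mmat a pi) *m a j) <= b ->
  ip (a j) (invmx (Mmat a p) *m a j) <= b / c.
Proof.
have Pu := mixed_Mmat_unit.
move=> h; rewrite ler_pdivlMr//; apply: le_trans h.
set u := invmx (Mmat a p) *m a j; set w := invmx (Mmat a pi) *m a j.
have Pu' : Mmat a p *m u = a j by rewrite /u mulKVmx.
have Qw : Mmat a pi *m w = a j by rewrite /w mulKVmx.
have : 0 <= \sum_(i < K) pi i * (c * ip (a i) u - ip (a i) w) ^+ 2.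
  by apply: sumr_ge0 => k _; rewrite mulr_ge0// sqr_ge0.
have -> : \sum_(i < K) pi i * (c * ip (a i) u - ip (a i) w) ^+ 2 =
    c * (\sum_(i < K) (c * pi i) * (ip (a i) u * ip (a i) u))
    - 2 * c * (\sum_(i < K) pi i * (ip (a i) u * ip (a i) w))
    + \sum_(i < K) pi i * (ip (a i) w * ip (a i) w).
  by rewrite !mulr_sumr -sumrN -!big_split/=; apply: eq_bigr => i _; ring.
set S := \sum_(i < K) c * _ * _.
rewrite -!ip_Mmat Qw [ip u _]ipC [ip w _]ipC.
have : c * S <= c * ip (a j) u.
  rewrite ler_pM2l// ipC -[in leRHS]Pu' ip_Mmat; apply: ler_sum => i _.
  by rewrite ler_wpM2r// -expr2 sqr_ge0.
lra.
Qed.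

End MixedExploration.

(** * One round of AdaHedge from a given state *)

Section AdaHedgeStep.
Variables (R : realType) (d K : nat) (a : 'I_K -> 'cV[R]_d).
Hypothesis K2 : (2 <= K)%N.
Implicit Types (s : state R d) (u : 'cV[R]_d) (x : 'I_K).

Let i0 : 'I_K := Ordinal (ltn_trans (isT : (0 < 1)%N) K2).

Let lnK_gt0 : 0 < ln (K%:R : R).
Proof. by rewrite ln_gt0// ltr1n. Qed.

Lemma qdist_distr s : is_distr (qdist a s).
Proof.
rewrite /qdist; case: (eta_of K s) => [e|/=].
  set Z := \sum_(j < K) _.
  have Z0 : 0 < Z.
    rewrite /Z (bigD1 i0)//= ltr_pwDl ?expR_gt0//.
    by apply: sumr_ge0 => j _; exact: expR_ge0.
  split=> [i|]; first by rewrite divr_ge0 ?expR_ge0// ltW.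
  by rewrite -mulr_suml mulfV// gt_eqF.
set A := [set j | _].
(* At infinite rate the weights are uniform over the maximizers, so one must exist for them to sum
   to one. *)
have [j jmax] : exists j, forall k, ip (a k) (cumY s) <= ip (a j) (cumY s).
  have [j _ jmax] := @Order.TotalTheory.arg_maxP _ _ _ i0 xpredT
    (fun i => ip (a i) (cumY s)) isT.
  by exists j => k; exact: jmax.
have A0 : (0 < #|A|)%N.
  by apply/card_gt0P; exists j; rewrite inE; apply/forallP.
split=> [i|]; first by case: ifP; rewrite ?divr_ge0.
rewrite -big_mkcond/= sumr_const -[_ *+ _]mulr_natr mul1r mulVf//.
by rewrite pnatr_eq0 -lt0n.
Qed.

(** This is the increment [delta] of [step] for an arbitrary vector u. The default of the maximum is
    itself one of the values compared, so it does not change the result. *)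
Definition sgap s u x : R :=
  match eta_of K s with
  | Some e => gap e (qdist a s) (fun i => ip (a i) u)
  | None => - mean (qdist a s) (fun i => ip (a i) u)
            + \big[Num.max/ip (a x) u]_(i < K) ip (a i) u
  end.

Section OneStep.
Variables (s : state R d) (u : 'cV[R]_d) (x : 'I_K).
Hypothesis D0 : 0 <= cumD s.
Let q := qdist a s.
Let g i := ip (a i) u.
Let qd : is_distr q := qdist_distr s.

Let le_max i : g i <= \big[Num.max/g x]_(i < K) g i.
Proof. exact: le_bigmax. Qed.

Let eta_gt0 e : eta_of K s = Some e -> 0 < cumD s /\ e = ln K%:R / cumD s.
Proof.
by rewrite /eta_of; case: eqVneq => // Dn0 [<-]; rewrite lt_def Dn0.
Qed.

Let eta_None : eta_of K s = None -> cumD s = 0.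
Proof. by rewrite /eta_of; case: eqVneq. Qed.

Lemma sgap_ge0 : 0 <= sgap s u x.
Proof.
rewrite /sgap; case eqe : (eta_of K s) => [e|].
  have [Dp ->] := eta_gt0 eqe.
  by apply: gap_ge0 => //; rewrite divr_gt0.
by rewrite addrC subr_ge0; apply: mean_le.
Qed.

Variables (b : R).
Hypothesis gb : forall i, `|g i| <= b / 2.

Let b0 : 0 <= b.
Proof. by have := le_trans (normr_ge0 _) (gb i0); lra. Qed.

Let gap_range i : g i - mean q g <= b.
Proof.
have : - (b / 2) <= mean q g.
  by apply: mean_ge => // j; have := gb j; rewrite ler_norml => /andP[].
by have := gb i; rewrite ler_norml => /andP[]; lra.
Qed.

Lemma sgap_le : sgap s u x <= b.
Proof.
rewrite /sgap; case eqe : (eta_of K s) => [e|].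
  have [Dp ->] := eta_gt0 eqe.
  by apply: gap_le => //; rewrite divr_gt0.
rewrite addrC lerBlDr; apply: bigmax_le => [|i _].
  by rewrite -lerBlDr; exact: gap_range.
by rewrite -lerBlDr; exact: gap_range.
Qed.

(** This is [gap_bernstein] at e = ln K / D; at infinite rate D = 0 and the left side vanishes. *)
Lemma cumD_sgap_le : 2 * cumD s * sgap s u x <=
  ln K%:R * (\sum_(i < K) q i * g i ^+ 2 + 2 / 3 * b * sgap s u x).
Proof.
have rhs0 : 0 <= \sum_(i < K) q i * g i ^+ 2 + 2 / 3 * b * sgap s u x.
  rewrite addr_ge0//; last by rewrite !mulr_ge0 ?sgap_ge0.
  by apply: sumr_ge0 => i _; rewrite mulr_ge0 ?sqr_ge0//; case: qd.
case eqe : (eta_of K s) => [e|]; last first.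
  by rewrite (eta_None eqe) mulr0 mul0r mulr_ge0// ltW.
have [Dp eE] := eta_gt0 eqe.
have e0 : 0 < e by rewrite eE divr_gt0.
have := gap_bernstein qd e0 b0 gap_range.
rewrite /sgap eqe -/q -(ler_pM2l lnK_gt0); apply: le_trans.
by rewrite eE le_eqVlt; apply/orP; left; apply/eqP; field; rewrite !gt_eqF.
Qed.

(** Expanding the square, delta^2 is at most b delta, and [cumD_sgap_le] handles the cross term. *)
Lemma cumD_sqr_step : (cumD s + sgap s u x) ^+ 2 <=
  cumD s ^+ 2 + ln K%:R * (\sum_(i < K) q i * g i ^+ 2)
  + (2 / 3 * ln K%:R + 1) * b * sgap s u x.
Proof.
have := cumD_sgap_le; have := sgap_ge0; have := sgap_le.
move=> /(ler_wpM2r sgap_ge0); rewrite sqrrD expr2; lra.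
Qed.

End OneStep.

Lemma expw_le_sgap s u x C : 0 <= cumD s ->
  expw_le (cumD s) (fun i => ip (a i) (cumY s)) C ->
  expw_le (cumD s + sgap s u x) (fun i => ip (a i) (cumY s + u))
    (C + (mean (qdist a s) (fun i => ip (a i) u) + sgap s u x)).
Proof.
(* The round is played at the old rate; monotonicity then passes to the smaller new one. *)
move=> D0 h; apply: (@expw_le_mono _ _ K2 (cumD s)) => //.
  by rewrite lerDl sgap_ge0.
under [X in expw_le _ X _]eq_fun do rewrite ipDr.
move: h; rewrite /sgap; case eqe : (eta_of K s) => [e|] h.
  have [Dp eE] : 0 < cumD s /\ e = ln K%:R / cumD s.
    by move: eqe; rewrite /eta_of; case: eqVneq => // Dn0 [<-]; rewrite lt_def Dn0.
  rewrite eE; apply: expw_le_step => // i.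
  by rewrite /qdist eqe eE.
(* At infinite rate [mean] plus [sgap] is the maximum of the new gains, and C bounds every old
   one. *)
have D00 : cumD s = 0 by move: eqe; rewrite /eta_of; case: eqVneq.
move: h; rewrite /expw_le D00 eqxx => h i.
rewrite addNKr lerD//.
exact: (@le_bigmax _ _ _ _ (fun i => ip (a i) u) i).
Qed.

End AdaHedgeStep.

(** * Expectations over random trajectories *)

Section Trajectories.
Variables (R : realType) (d K : nat) (a : 'I_K -> 'cV[R]_d) (pi : 'I_K -> R).
Variable y : nat -> 'cV[R]_d.
Implicit Types (h : seq 'I_K) (f : seq 'I_K -> 'I_K -> R) (F : seq 'I_K -> R) (x : 'I_K).

Local Notation st := (state_after a pi y).
Local Notation p_ h := (pdist a pi (size h).+1 (st h)).

Lemma state_after_rcons h x :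
  st (rcons h x) = step a pi y (size h).+1 (st h) x.
Proof.
have sizeE h' t s : (foldl (fun ts z => (ts.1.+1, step a pi y ts.1.+1 ts.2 z))
    (t, s) h').1 = (t + size h')%N.
  by elim: h' t s => [|z h' ih] t s /=; rewrite ?addn0// ih addSnnS.
by rewrite /state_after foldl_rcons/= sizeE.
Qed.

Definition traj_expect T F : R :=
  \sum_(h : T.-tuple 'I_K) traj_prob a pi y h * F h.

(** [f] receives the actions before a round and the action of that round, so rewards, estimates and
    second moments are all sums of this shape. *)
Definition hist_sum (f : seq 'I_K -> 'I_K -> R) h : R :=
  \sum_(i < size h) f (take i h) (tnth (in_tuple h) i).

Lemma hist_sum_rcons f h x : hist_sum f (rcons h x) = hist_sum f h + f h x.
Proof.
have tnthE h' (i : 'I_(size h')) : tnth (in_tuple h') i = nth x h' i.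
  by rewrite (tnth_nth x).
rewrite /hist_sum; under eq_bigr do rewrite tnthE.
under [in RHS]eq_bigr do rewrite tnthE.
rewrite -(big_mkord xpredT (fun i => f (take i (rcons h x)) (nth x (rcons h x) i))).
rewrite -(big_mkord xpredT (fun i => f (take i h) (nth x h i))).
rewrite size_rcons big_nat_recr//= nth_rcons ltnn eqxx -cats1 take_size_cat//.
congr (_ + _); apply: eq_big_nat => i /andP[_ ih].
by rewrite take_cat nth_cat ih.
Qed.

Lemma hist_sum_nil f : hist_sum f [::] = 0.
Proof. by rewrite /hist_sum big_ord0. Qed.

Lemma traj_expect0 F : traj_expect 0 F = F [::].
Proof.
rewrite /traj_expect (bigD1 [tuple])//= big1 ?addr0.
  by rewrite /traj_prob big_ord0 mul1r.
by move=> h /eqP[]; exact: tuple0.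
Qed.

(** Tower rule: condition on the first T actions and average over the last one. *)
Lemma traj_expectS T F : traj_expect T.+1 F =
  traj_expect T (fun h => \sum_(x < K) p_ h x * F (rcons h x)).
Proof.
rewrite /traj_expect.
under [RHS]eq_bigr do rewrite mulr_sumr.
rewrite pair_big/=.
rewrite (reindex (fun hx : T.-tuple 'I_K * 'I_K => [tuple of rcons hx.1 hx.2]))/=; last first.
  apply: onW_bij; apply: inj_card_bij => [[h x] [h' x'] /(congr1 val)/=|].
    by move=> /rcons_inj[/val_inj-> ->].
  by rewrite card_prod !card_tuple card_ord expnSr.
apply: eq_bigr => -[h x] _ /=; rewrite mulrA; congr (_ * _).
rewrite /traj_prob big_ord_recr/=; congr (_ * _).
  apply: eq_bigr => i _.
  rewrite (tnth_nth x)/= nth_rcons size_tuple ltn_ord -tnth_nth.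
  congr (pdist a pi _ (st _) _).
  by rewrite -cats1 takel_cat// size_tuple ltnW.
rewrite (tnth_nth x)/= nth_rcons size_tuple ltnn eqxx.
by rewrite -cats1 take_size_cat ?size_tuple.
Qed.

Hypothesis p_distr : forall h, is_distr (p_ h).

Lemma traj_expect_le T F F' : (forall h, size h = T -> F h <= F' h) ->
  traj_expect T F <= traj_expect T F'.
Proof.
elim: T F F' => [|T ih] F F' FF'; first by rewrite !traj_expect0 FF'.
rewrite !traj_expectS; apply: ih => h hT; apply: ler_sum => x _.
by rewrite ler_wpM2l ?(p_distr h).1// FF'// size_rcons hT.
Qed.

Lemma traj_expect_cst T (c : R) : traj_expect T (fun=> c) = c.
Proof.
elim: T => [|T ih]; first by rewrite traj_expect0.
rewrite traj_expectS -[RHS]ih; apply: eq_bigr => h _; congr (_ * _).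
by rewrite -mulr_suml (p_distr h).2 mul1r.
Qed.

Lemma traj_expectD T F F' :
  traj_expect T (fun h => F h + F' h) = traj_expect T F + traj_expect T F'.
Proof.
by rewrite /traj_expect -big_split/=; apply: eq_bigr => h _; rewrite mulrDr.
Qed.

Lemma traj_expect_hist_sum_le T f (c : nat -> R) :
  (forall h, (size h < T)%N -> \sum_(x < K) p_ h x * f h x <= c (size h)) ->
  traj_expect T (hist_sum f) <= \sum_(i < T) c i.
Proof.
elim: T => [|T ih] fc.
  by rewrite traj_expect0 hist_sum_nil big_ord0.
rewrite traj_expectS big_ord_recr/=.
apply: le_trans (_ : traj_expect T (fun h => hist_sum f h + c T) <= _).
  apply: traj_expect_le => h hT.
  under eq_bigr do rewrite hist_sum_rcons mulrDr.
  rewrite big_split/= -mulr_suml (p_distr h).2 mul1r lerD2l -[in leRHS]hT.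
  by apply: fc; rewrite hT.
rewrite traj_expectD traj_expect_cst lerD2r; apply: ih => h hT.
by apply: fc; rewrite ltnS ltnW.
Qed.

End Trajectories.

(** * The regret bound and its constants *)

Section Regret.
Variables (R : realType) (d K : nat) (a : 'I_K -> 'cV[R]_d) (pi : 'I_K -> R).
Variables (y : nat -> 'cV[R]_d) (m M : R).
Hypotheses (d0 : (0 < d)%N) (K2 : (2 <= K)%N) (piE : good_exploration a pi).
Hypotheses (mM : m < M) (m0 : m <= 0) (M0 : 0 <= M).
Hypothesis ym : forall t, (1 <= t)%N -> forall x, m <= ip (a x) (y t) <= M.
Implicit Types (h : seq 'I_K) (x i : 'I_K) (t T : nat).

Local Notation st := (state_after a pi y).
Local Notation q_ h := (qdist a (st h)).
Local Notation p_ h := (pdist a pi (size h).+1 (st h)).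
Local Notation lnK := (ln (K%:R : R)).

Lemma lnK_ge : 19 / 30 <= lnK.
Proof.
apply: le_trans (ln2_ge R) _.
by rewrite ler_ln ?posrE ?ltr0n ?ler_nat// (ltn_trans _ K2).
Qed.

Let lnK_gt0 : 0 < lnK.
Proof. by apply: lt_le_trans lnK_ge; lra. Qed.

Let dR0 : 0 < d%:R :> R. Proof. by rewrite ltr0n. Qed.

Lemma gamma_gt0 t : (0 < t)%N -> 0 < gamma R d K t.
Proof.
move=> t0; rewrite /gamma lt_min; apply/andP; split; first lra.
by rewrite divr_gt0 ?sqrtr_gt0 ?ltr0n// !mulr_gt0//; lra.
Qed.

Lemma gamma_le_half t : gamma R d K t <= 1 / 2.
Proof. by rewrite /gamma ge_min lexx. Qed.

Lemma gamma_nincr s t : (0 < s)%N -> (s <= t)%N -> gamma R d K t <= gamma R d K s.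
Proof.
move=> s0 st; have t0 := leq_trans s0 st.
rewrite /gamma le_min !ge_min lexx/=; apply/orP; right.
by rewrite ler_wpM2l ?sqrtr_ge0// lef_pV2 ?posrE ?sqrtr_gt0 ?ltr0n// ler_wsqrtr// ler_nat.
Qed.

Lemma pdist_ge_pi t s i : (0 < t)%N -> gamma R d K t * pi i <= pdist a pi t s i.
Proof.
move=> t0; rewrite /pdist lerDr mulr_ge0 ?(qdist_distr a K2 s).1//.
by have := gamma_le_half t; lra.
Qed.

(** The cap at 1/2 keeps [1 - gamma] at least 1/2; the price is a factor 2 in the second moment. *)
Lemma qdist_le_pdist t s i : (0 < t)%N -> qdist a s i <= 2 * pdist a pi t s i.
Proof.
move=> t0; have q0 := (qdist_distr a K2 s).1 i.
have := mulr_ge0 (ltW (gamma_gt0 t0)) (piE.1.1 i).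
have : (1 / 2) * qdist a s i <= (1 - gamma R d K t) * qdist a s i.
  by rewrite ler_wpM2r//; have := gamma_le_half t; lra.
rewrite /pdist; lra.
Qed.

Lemma pdist_distr t s : (0 < t)%N -> is_distr (pdist a pi t s).
Proof.
move=> t0; have [[pi0 pi1] _] := piE; split=> [i|].
  by apply: le_trans (pdist_ge_pi s i t0); rewrite mulr_ge0// ltW// gamma_gt0.
rewrite big_split/= -!mulr_sumr pi1 (qdist_distr a K2 s).2; ring.
Qed.

Lemma pdist_unit t s : (0 < t)%N -> Mmat a (pdist a pi t s) \in unitmx.
Proof.
move=> t0; have [[pi0 _] [Qu _]] := piE.
by apply: (mixed_Mmat_unit (gamma_gt0 t0) pi0 _ Qu) => i; exact: pdist_ge_pi.
Qed.

Definition estimate t s x : 'cV[R]_d :=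
  ip (a x) (y t) *: (invmx (Mmat a (pdist a pi t s)) *m a x).

Lemma step_estimate t s x : step a pi y t s x =
  State (cumY s + estimate t s x) (cumD s + sgap a s (estimate t s x) x).
Proof. by []. Qed.

Lemma reward_abs_le t x : (0 < t)%N -> `|ip (a x) (y t)| <= M - m.
Proof.
move=> t0; have /andP[ym1 ym2] := ym t0 x.
by have := m0; have := M0; rewrite ler_norml => ? ?; apply/andP; split; lra.
Qed.

Lemma estimate_abs_le t s i x : (0 < t)%N ->
  `|ip (a i) (estimate t s x)| <= (M - m) * (d%:R / gamma R d K t).
Proof.
move=> t0; have [[pi0 _] [Qu [Qd _]]] := piE.
rewrite /estimate ipZr normrM ler_pM ?reward_abs_le//.
apply: ip_est_abs_le => [k|| j]; first exact: (pdist_distr s t0).1.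
  exact: pdist_unit.
apply: (mixed_ip_est_le (gamma_gt0 t0) pi0 _ Qu) => [k|]; first exact: pdist_ge_pi.
by have := Qd j; rewrite /ip mulmxA.
Qed.

Lemma expect_estimate t s x : (0 < t)%N ->
  \sum_(j < K) pdist a pi t s j * ip (a x) (estimate t s j) = ip (a x) (y t).
Proof.
move=> t0; rewrite -(sum_ip_est_unbiased (pdist_unit s t0) (a x) (y t)).
by apply: eq_bigr => j _; rewrite /estimate ipZr.
Qed.

(** For a fixed draw j, replacing q by 2 p turns the inner sum into 2 <a_j, y>^2 <a_j, P^-1 a_j>;
    the trace identity averages the last factor to d. *)
Lemma expect_estimate_sqr t s : (0 < t)%N ->
  \sum_(j < K) pdist a pi t s j *
     (\sum_(i < K) qdist a s i * ip (a i) (estimate t s j) ^+ 2)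
  <= 2 * d%:R * (M - m) ^+ 2.
Proof.
move=> t0; have [p0 _] := pdist_distr s t0; have Pu := pdist_unit s t0.
rewrite mulrAC -[X in _ * X](sum_ip_est_trace Pu) mulr_sumr.
apply: ler_sum => j _; rewrite mulrCA ler_wpM2l//.
apply: (@le_trans _ _ (2 * \sum_(i < K) pdist a pi t s i * ip (a i) (estimate t s j) ^+ 2)).
  rewrite mulr_sumr; apply: ler_sum => i _.
  by rewrite mulrA ler_wpM2r ?sqr_ge0// qdist_le_pdist.
rewrite -[leRHS]mulrA ler_pM2l//.
under eq_bigr do rewrite /estimate ipZr exprMn mulrCA.
rewrite -mulr_sumr (sum_ip_est_sqr Pu) ler_wpM2r ?ip_est_ge0//.
rewrite -[leLHS]real_normK ?num_real// lerXn2r ?nnegrE// ?reward_abs_le//.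
by rewrite subr_ge0 ltW.
Qed.

Let est h x := estimate (size h).+1 (st h) x.
Let hmean h x := mean (q_ h) (fun i => ip (a i) (est h x)).
Let hsqr h x := \sum_(i < K) q_ h i * ip (a i) (est h x) ^+ 2.

Lemma cumD_ge0 h : 0 <= cumD (st h).
Proof.
elim/last_ind: h => [|h x ih]; first exact: lexx.
by rewrite state_after_rcons step_estimate/= addr_ge0// sgap_ge0.
Qed.

Lemma cumY_hist_sum x h :
  ip (a x) (cumY (st h)) = hist_sum (fun h j => ip (a x) (est h j)) h.
Proof.
elim/last_ind: h => [|h j ih]; first by rewrite hist_sum_nil ip0r.
by rewrite state_after_rcons step_estimate/= ipDr ih hist_sum_rcons.
Qed.

Lemma expw_le_state h : expw_le (cumD (st h)) (fun i => ip (a i) (cumY (st h)))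
  (hist_sum hmean h + cumD (st h)).
Proof.
elim/last_ind: h => [|h x ih].
  by rewrite hist_sum_nil add0r /expw_le eqxx => i; rewrite ip0r.
rewrite state_after_rcons step_estimate/= hist_sum_rcons addrACA.
exact: expw_le_sgap (cumD_ge0 h) ih.
Qed.

(** One [cumD] is the sum of gaps in [expw_le_state], the other is the overhead ln K / eta of
    [expw_le_bound]. *)
Lemma hedge_regret x h : ip (a x) (cumY (st h)) <=
  hist_sum hmean h + 2 * cumD (st h).
Proof.
have := expw_le_bound K2 x (cumD_ge0 h) (expw_le_state h); lra.
Qed.

(** Induction on the history with T fixed: [gamma] is nonincreasing, so the range bound at T serves
    for all earlier rounds. *)
Lemma cumD_sqr_le T h : (size h <= T)%N -> cumD (st h) ^+ 2 <=
  lnK * hist_sum hsqr h +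
  (2 / 3 * lnK + 1) * (2 * (M - m) * (d%:R / gamma R d K T)) * cumD (st h).
Proof.
elim/last_ind: h => [|h x ih].
  by rewrite hist_sum_nil expr0n/= !mulr0 addr0.
rewrite size_rcons => hT; have {ih}ih := ih (ltnW hT).
rewrite state_after_rcons step_estimate/= hist_sum_rcons.
set b := 2 * (M - m) * _ in ih *.
have estb i : `|ip (a i) (est h x)| <= b / 2.
  apply: le_trans (estimate_abs_le _ _ _ _) _ => //.
  have -> : b / 2 = (M - m) * (d%:R / gamma R d K T)
    by rewrite /b; field; rewrite gt_eqF// gamma_gt0// (leq_trans _ hT).
  rewrite ler_pM2l ?subr_gt0// ler_pM2l// lef_pV2 ?posrE ?gamma_gt0 ?(leq_trans _ hT)//.
  exact: gamma_nincr.
have := cumD_sqr_step K2 x (cumD_ge0 h) estb; rewrite -/(est h x) -/(hsqr h x); lra.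
Qed.

Lemma expected_reward_hist_sum T : expected_reward a pi y T =
  traj_expect a pi y T (hist_sum (fun h x => ip (a x) (y (size h).+1))).
Proof.
apply: eq_bigr => h _; congr (_ * _).
have -> : hist_sum (fun h x => ip (a x) (y (size h).+1)) h =
    \sum_(i < size h) ip (a (tnth (in_tuple h) i)) (y i.+1).
  by apply: eq_bigr => i _; rewrite size_takel// ltnW.
have i0 : 'I_K := Ordinal (ltn_trans (isT : (0 < 1)%N) K2).
under [RHS]eq_bigr do rewrite (tnth_nth i0)/=.
under [LHS]eq_bigr do rewrite (tnth_nth i0).
rewrite -(big_mkord xpredT (fun k => ip (a (nth i0 h k)) (y k.+1))).
rewrite -(big_mkord xpredT (fun k => ip (a (nth i0 h k)) (y k.+1))).
by rewrite size_tuple.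
Qed.

Lemma expect_bias t s : (0 < t)%N ->
  \sum_(i < K) qdist a s i * ip (a i) (y t)
  - \sum_(i < K) pdist a pi t s i * ip (a i) (y t) <= gamma R d K t * (M - m).
Proof.
move=> t0; have [pid _] := piE.
have -> : \sum_(i < K) qdist a s i * ip (a i) (y t)
    - \sum_(i < K) pdist a pi t s i * ip (a i) (y t) =
    gamma R d K t * (mean (qdist a s) (fun i => ip (a i) (y t))
                     - mean pi (fun i => ip (a i) (y t))).
  rewrite /mean -!sumrB mulr_sumr; apply: eq_bigr => i _; rewrite /pdist; ring.
rewrite ler_pM2l ?gamma_gt0// lerB//.
  by apply: mean_le => [|i]; [exact: qdist_distr | have /andP[] := ym t0 i].
by apply: mean_ge => // i; have /andP[] := ym t0 i.
Qed.

(** The weights q depend only on the past, so averaging over the current draw replaces the unbiased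
    estimate by y. *)
Lemma expect_hmean h :
  \sum_(j < K) p_ h j * hmean h j =
  \sum_(i < K) q_ h i * ip (a i) (y (size h).+1).
Proof.
rewrite /hmean /mean; under eq_bigr do rewrite mulr_sumr.
rewrite exchange_big/=; apply: eq_bigr => i _.
rewrite -(expect_estimate (st h) i (ltn0Sn (size h))) mulr_sumr.
by apply: eq_bigr => j _; rewrite mulrCA.
Qed.

(** The inequality D^2 <= ln K V + B D is linearized on each trajectory at a deterministic point l
    before averaging, so only a bound on the expectation of V is needed. *)
Lemma adahedge_regret x T : (0 < T)%N ->
  \sum_(t < T) ip (a x) (y t.+1) - expected_reward a pi y T <=
  (M - m) * (\sum_(t < T) gamma R d K t.+1)
  + 2 * (Num.sqrt (lnK * (2 * d%:R * (M - m) ^+ 2 * T%:R))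
         + (2 / 3 * lnK + 1) * (2 * (M - m) * (d%:R / gamma R d K T))).
Proof.
move=> T0; have pd h : is_distr (p_ h) by exact: pdist_distr.
set W := 2 * d%:R * (M - m) ^+ 2 * T%:R.
set B := (2 / 3 * lnK + 1) * _.
have gT0 := gamma_gt0 T0.
have Mm0 : 0 < M - m by rewrite subr_gt0.
have B0 : 0 < B.
  apply: mulr_gt0; first by rewrite ltr_wpDl// mulr_ge0// ltW.
  by apply: mulr_gt0; [exact: mulr_gt0 | exact: divr_gt0].
set r := Num.sqrt (lnK * W).
have r0 : 0 <= r := sqrtr_ge0 _.
have r2 : r ^+ 2 = lnK * W.
  rewrite sqr_sqrtr//; apply: mulr_ge0; first exact: ltW.
  by rewrite /W mulr_ge0// mulr_ge0 ?sqr_ge0// mulr_ge0.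
(* From D^2 >= 2 l D - l^2 follows (2 l - B) D <= l^2 + ln K V; [k] is the resulting factor for 2
   D. *)
pose l := r + B; have lB : 0 < 2 * l - B by rewrite /l; lra.
pose k := 2 / (2 * l - B); have k0 : 0 < k by rewrite divr_gt0.
(* Per-round excess: <x, y> minus its estimate has conditional mean zero, [hmean] minus the reward
   is the exploration bias, and [hsqr] carries the linearized gap. *)
pose f h j := ip (a x) (y (size h).+1) - ip (a j) (y (size h).+1)
  - ip (a x) (est h j) + hmean h j + k * lnK * hsqr h j.
pose rew := hist_sum (fun h j => ip (a j) (y (size h).+1)).
have fE h : hist_sum f h = \sum_(t < size h) ip (a x) (y t.+1) - rew h
    - ip (a x) (cumY (st h)) + hist_sum hmean h + k * lnK * hist_sum hsqr h.
  rewrite cumY_hist_sum /rew.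
  elim/last_ind: h => [|h j ih]; first by rewrite !hist_sum_nil big_ord0; ring.
  by rewrite !hist_sum_rcons ih size_rcons big_ord_recr/= {1}/f; ring.
have path h : size h = T ->
    \sum_(t < T) ip (a x) (y t.+1) <= rew h + (hist_sum f h + k * l ^+ 2).
  move=> hT; rewrite fE hT.
  have := hedge_regret x h.
  have hT' : (size h <= T)%N by rewrite hT.
  have := cumD_sqr_le hT'; rewrite -/B.
  set D := cumD (st h); set V := hist_sum hsqr h => hD hr.
  have : 2 * D <= k * (l ^+ 2 + lnK * V).
    rewrite /k mulrAC ler_pdivlMr// -mulrA ler_pM2l//.
    by have := sqr_ge0 (D - l); rewrite sqrrB; lra.
  by rewrite mulrDr mulrA; lra.
have := traj_expect_le pd path.
rewrite traj_expect_cst// traj_expectD -expected_reward_hist_sum.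
rewrite traj_expectD traj_expect_cst//.
have : traj_expect a pi y T (hist_sum f) <=
    \sum_(t < T) (gamma R d K t.+1 * (M - m)
                  + k * lnK * (2 * d%:R * (M - m) ^+ 2)).
  apply: (traj_expect_hist_sum_le pd
    (c := fun t => gamma R d K t.+1 * (M - m) + k * lnK * (2 * d%:R * (M - m) ^+ 2))) => h _.
  have t0 := ltn0Sn (size h).
  have -> : \sum_(j < K) p_ h j * f h j =
      (\sum_(j < K) p_ h j) * ip (a x) (y (size h).+1)
      - \sum_(j < K) p_ h j * ip (a j) (y (size h).+1)
      - \sum_(j < K) p_ h j * ip (a x) (est h j)
      + \sum_(j < K) p_ h j * hmean h j
      + k * lnK * \sum_(j < K) p_ h j * hsqr h j.
    rewrite mulr_suml mulr_sumr -!sumrB -!big_split/=.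
    by apply: eq_bigr => j _; rewrite /f; ring.
  rewrite (pd h).2 mul1r expect_estimate// expect_hmean.
  have := expect_bias (st h) t0.
  have : k * lnK * \sum_(j < K) p_ h j * hsqr h j <= k * lnK * (2 * d%:R * (M - m) ^+ 2).
    apply: ler_wpM2l; first exact: mulr_ge0 (ltW k0) (ltW lnK_gt0).
    exact: expect_estimate_sqr.
  lra.
rewrite big_split/= -mulr_suml sumr_const card_ord -[_ *+ T]mulr_natr.
(* With l = r + B this reads 2 r^2 + 2 r B + B^2 <= (r + B) (2 r + B), that is r B >= 0. *)
have : k * (l ^+ 2 + lnK * W) <= 2 * (r + B).
  rewrite /k mulrAC ler_pdivrMr// -[leRHS]mulrA ler_pM2l// -r2 /l.
  by have := mulr_ge0 r0 (ltW B0); lra.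
by rewrite /W; lra.
Qed.

Lemma sum_gamma_le T : \sum_(t < T) gamma R d K t.+1 <=
  2 * Num.sqrt (5 / 2) * Num.sqrt (d%:R * T%:R * lnK).
Proof.
apply: (@le_trans _ _ (\sum_(t < T)
    Num.sqrt (5 / 2 * d%:R * lnK) * (Num.sqrt (t.+1%:R : R))^-1)).
  by apply: ler_sum => t _; rewrite /gamma ge_min lexx orbT.
rewrite -mulr_sumr.
have -> : 2 * Num.sqrt (5 / 2) * Num.sqrt (d%:R * T%:R * lnK) =
    Num.sqrt (5 / 2 * d%:R * lnK) * (2 * Num.sqrt T%:R).
  rewrite [RHS]mulrCA -!mulrA -!sqrtrM ?mulr_ge0 ?divr_ge0 ?ltW//.
  by congr (_ * Num.sqrt _); ring.
by rewrite ler_wpM2l ?sqrtr_ge0 ?sum_inv_sqrt.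
Qed.

(** The reciprocal of a minimum is the maximum of the reciprocals, bounded here by their sum. *)
Lemma inv_gamma_le T : (0 < T)%N -> d%:R / gamma R d K T <=
  2 * d%:R + Num.sqrt (d%:R * T%:R * lnK) / (Num.sqrt (5 / 2) * lnK).
Proof.
move=> T0; have TR0 : 0 < T%:R :> R by rewrite ltr0n.
have s0 : 0 < Num.sqrt (5 / 2 : R) by rewrite sqrtr_gt0 divr_gt0.
have X0 : 0 <= Num.sqrt (d%:R * T%:R * lnK) / (Num.sqrt (5 / 2) * lnK).
  by rewrite divr_ge0 ?sqrtr_ge0// mulr_ge0// ltW.
rewrite /gamma minEle; case: ifP => _.
  by rewrite div1r invrK mulrC lerDl.
have -> : d%:R / (Num.sqrt (5 / 2 * d%:R * lnK) / Num.sqrt T%:R) =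
    Num.sqrt (d%:R * T%:R * lnK) / (Num.sqrt (5 / 2) * lnK).
  have e1 : Num.sqrt (d%:R * T%:R * lnK) =
      Num.sqrt T%:R * Num.sqrt (d%:R * lnK).
    by rewrite -sqrtrM ?ltW//; congr Num.sqrt; ring.
  have e2 : Num.sqrt (5 / 2 * d%:R * lnK) = Num.sqrt (5 / 2) * Num.sqrt (d%:R * lnK).
    by rewrite -sqrtrM ?divr_ge0//; congr Num.sqrt; ring.
  have e3 : d%:R = Num.sqrt (d%:R * lnK) ^+ 2 / lnK.
    by rewrite sqr_sqrtr ?mulr_ge0 ?ltW// mulfK// gt_eqF.
  have dl0 : 0 < Num.sqrt (d%:R * lnK) by rewrite sqrtr_gt0 mulr_gt0.
  rewrite e1 e2 {1}e3; field.
  by rewrite !gt_eqF// sqrtr_gt0.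
by rewrite lerDr mulr_ge0 ?ltW.
Qed.

Lemma regret_constants (L X D : R) : 19 / 30 <= L -> 0 <= X -> 0 <= D ->
  2 * Num.sqrt (5 / 2) * X + 2 * (Num.sqrt 2 * X
    + (2 / 3 * L + 1) * (2 * (2 * D + X / (Num.sqrt (5 / 2) * L))))
  <= 12 * X + 18 * (D * L).
Proof.
move=> L_ge X0 D0; have L0 : 0 < L by lra.
set s := Num.sqrt (5 / 2); set s2 := Num.sqrt 2.
have s_ge0 : 0 <= s := sqrtr_ge0 _.
have s2_ge0 : 0 <= s2 := sqrtr_ge0 _.
have sE : s ^+ 2 = 5 / 2 by rewrite sqr_sqrtr// divr_ge0.
have s2E : s2 ^+ 2 = 2 by rewrite sqr_sqrtr.
have s_le : s <= 8 / 5 by nra.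
have s_ge : 11 / 7 <= s by nra.
have s2_le : s2 <= 3 / 2 by nra.
have sX : s * X <= 8 / 5 * X by rewrite ler_wpM2r.
have s2X : s2 * X <= 3 / 2 * X by rewrite ler_wpM2r.
pose w := X / (s * L).
have w0 : 0 <= w by rewrite divr_ge0// mulr_ge0// ltW.
have wX : 11 / 7 * (L * w) <= X.
  have -> : X = s * (L * w) by rewrite /w; field; rewrite !gt_eqF//; lra.
  by rewrite ler_wpM2r// mulr_ge0// ltW.
rewrite -/w.
(* 9/4 - 2/3 = 19/12 and 19/12 * 19/30 = 361/360 >= 1. The coefficient of D L becomes 2 * 9/4 * 4 =
   18, and that of X at most 16/5 + 3 + 63/11 < 12. *)
have kL : 2 / 3 * L + 1 <= 9 / 4 * L by lra.
have : (2 / 3 * L + 1) * (2 * (2 * D + w)) <= 9 / 4 * L * (2 * (2 * D + w)).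
  by rewrite ler_wpM2r//; lra.
have := mulr_ge0 D0 (ltW L0).
lra.
Qed.

End Regret.

Theorem theorem5 (R : realType) (d K : nat) (a : 'I_K -> 'cV[R]_d)
  (pi : 'I_K -> R) :
  (2 <= K)%N -> injective a ->
  \rank (\matrix_(i < K) (a i)^T) = d ->
  good_exploration a pi ->
  forall (m M : R), m < M -> m <= 0 -> 0 <= M ->
  forall y : nat -> 'cV[R]_d,
    (forall t, (1 <= t)%N -> forall x, m <= ip (a x) (y t) <= M) ->
    forall T, (1 <= T)%N ->
      regret_le a pi y T
        (12 * (M - m) * Num.sqrt (d%:R * T%:R * ln K%:R)
         + 18 * (M - m) * d%:R * ln K%:R).
Proof.
move=> K2 a_inj _ piE m M mM m0 M0 y ym T T0 x.
(* In dimension 0 all columns coincide, against injectivity of [a] on at least two actions. *)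
have d0 : (0 < d)%N.
  rewrite lt0n; apply/eqP => dE; subst d.
  suff /a_inj : a (Ordinal (ltnW K2)) = a (Ordinal K2) by [].
  by apply/matrixP => -[].
have Mm0 : 0 < M - m by rewrite subr_gt0.
apply: le_trans (adahedge_regret d0 K2 piE mM m0 M0 ym x T0) _.
set X := Num.sqrt (d%:R * T%:R * ln K%:R).
have -> : Num.sqrt (ln K%:R * (2 * d%:R * (M - m) ^+ 2 * T%:R)) =
    (M - m) * (Num.sqrt 2 * X).
  have -> : ln K%:R * (2 * d%:R * (M - m) ^+ 2 * T%:R) =
      (M - m) ^+ 2 * (2 * (d%:R * T%:R * ln (K%:R : R))) by ring.
  by rewrite sqrtrM ?sqr_ge0// sqrtr_sqr gtr0_norm// sqrtrM.
have L_ge : 19 / 30 <= ln (K%:R : R) := lnK_ge R K2.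
have L0 : 0 < ln (K%:R : R) by apply: lt_le_trans L_ge; rewrite divr_gt0.
have h1 := sum_gamma_le R d0 K2 T; have h2 := inv_gamma_le R d0 K2 T0.
have := regret_constants L_ge (sqrtr_ge0 (d%:R * T%:R * ln K%:R)) (ler0n R d).
rewrite -/X in h1 h2 *.
set z := X / _ in h2 *; set g := \sum_(t < T) _ in h1 *; set G := d%:R / _ in h2 *.
move=> h.
have h3 : (2 / 3 * ln K%:R + 1) * (2 * G) <=
    (2 / 3 * ln K%:R + 1) * (2 * (2 * d%:R + z)).
  by rewrite ler_wpM2l ?ler_pM2l// addr_ge0// mulr_ge0// ltW.
apply: (@le_trans _ _ ((M - m) * (g + 2 * (Num.sqrt 2 * X
    + (2 / 3 * ln K%:R + 1) * (2 * G))))).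
  by rewrite le_eqVlt; apply/orP; left; apply/eqP; ring.
apply: (@le_trans _ _ ((M - m) * (12 * X + 18 * (d%:R * ln K%:R)))); last first.
  by rewrite le_eqVlt; apply/orP; left; apply/eqP; ring.
by rewrite ler_pM2l//; lra.
Qed.
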